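(* Let $p$ be an odd prime and let $r$ be an integer with $1\le r<p$. Let $x,c$ be indeterminates over $\mathbb{Q}_p$, and let $c_1,\dots,c_r$ (in a splitting field over $\mathbb{Q}_p(x)$) satisfy $x(c-1)^r+c^{r-1}=x\prod_{i=1}^r(c-c_i)$. Then $$\sum_{0<k<p/r}\binom{rk}{k}\frac{x^k}{k}\equiv -\sum_{i=1}^r\frac{\pounds_1(c_i)}{(1-c_i)^p}\pmod p.$$
   Context: $\pounds_1(t)=\sum_{k=1}^{p-1}t^k/k$ is the truncated logarithm. Interpretation of the congruence: both sides are symmetric in $c_1,\dots,c_r$ and hence lie in $\mathbb{Q}_p(x)$; for $A,B\in\mathbb{Q}_p(x)$, $A\equiv B\pmod{p^n}$ means $A-B\in p^nR$, where $R$ is the valuation ring of $\mathbb{Q}_p(x)$ with respect to the $p$-adic (Gauss) valuation, i.e. the valuation extending $v_p$ with $v(\sum_j a_jx^j)=\min_j v_p(a_j)$ on polynomials. *)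

(* Defs.v *)
From HB Require Import structures.
From mathcomp Require Import all_boot all_order all_algebra all_field.
From mathcomp Require Import boolp constructive_ereal.

Set Implicit Arguments.
Unset Strict Implicit.
Unset Printing Implicit Defensive.

Import Order.TTheory GRing.Theory Num.Theory.
Local Open Scope ring_scope.

(* Z_p is the inverse limit of the rings Z/p^(n+1), n >= 0.  The index starts
   at p^1 because 'Z_1 is not the trivial ring in MathComp. *)
Definition coherent (p : nat) (a : forall n, 'Z_(p ^ n.+1)) : Prop :=
  forall n, a n.+1 = a n %[mod p ^ n.+1].

Record padic_int (p : nat) (hp : prime p) := PadicInt {
  padic_seq :> forall n, 'Z_(p ^ n.+1);
  padic_seqP : `[< coherent padic_seq >] }.

HB.instance Definition _ p (hp : prime p) := [isSub for @padic_seq p hp].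
HB.instance Definition _ p (hp : prime p) := [Choice of padic_int hp by <:].

Section PadicIntRing.
Variables (p : nat) (hp : prime p).
Local Notation Z_p := (padic_int hp).
Implicit Types a b c : Z_p.

Lemma padic_pow_gt1 n : (1 < p ^ n.+1)%N.
Proof. by rewrite -(exp1n n.+1) ltn_exp2r // prime_gt1. Qed.

Lemma padic_modE n : (Zp_trunc (p ^ n.+1)).+2 = (p ^ n.+1)%N.
Proof. exact/Zp_cast/padic_pow_gt1. Qed.

Lemma val_padicD n (u v : 'Z_(p ^ n.+1)) :
  (u + v)%R = ((u + v) %% p ^ n.+1)%N :> nat.
Proof. exact: (congr1 (modn _) (padic_modE n)). Qed.

Lemma val_padicM n (u v : 'Z_(p ^ n.+1)) :
  (u * v)%R = ((u * v) %% p ^ n.+1)%N :> nat.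
Proof. exact: (congr1 (modn _) (padic_modE n)). Qed.

Lemma val_padicN n (u : 'Z_(p ^ n.+1)) :
  (- u)%R = ((p ^ n.+1 - u) %% p ^ n.+1)%N :> nat.
Proof. exact: (congr1 (fun m => ((m - u) %% m)%N) (padic_modE n)). Qed.

Lemma padic_ltn n (u : 'Z_(p ^ n.+1)) : (u < p ^ n.+1)%N.
Proof. by rewrite -[X in (_ < X)%N]padic_modE. Qed.

Lemma padic_intP a n : a n.+1 = a n %[mod p ^ n.+1].
Proof. by case: a => s /= /asboolP. Qed.

Lemma padic_ext a b : (forall n, a n = b n) -> a = b.
Proof. by move=> eab; apply/val_inj/functional_extensionality_dep. Qed.

Lemma padic_mod_dvd m n k : (m <= n)%N -> (k %% p ^ n = k %[mod p ^ m])%N.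
Proof. by move=> mn; rewrite modn_dvdm // dvdn_exp2l. Qed.

Definition padic_const k : forall n, 'Z_(p ^ n.+1) := fun n => k%:R.
Definition padic_add_seq a b : forall n, 'Z_(p ^ n.+1) := fun n => a n + b n.
Definition padic_opp_seq a : forall n, 'Z_(p ^ n.+1) := fun n => - a n.
Definition padic_mul_seq a b : forall n, 'Z_(p ^ n.+1) := fun n => a n * b n.

Lemma padic_const_subproof k : `[< coherent (padic_const k) >].
Proof.
apply/asboolP => n; rewrite /padic_const !val_Zp_nat ?padic_pow_gt1 //.
by rewrite !padic_mod_dvd.
Qed.

Lemma padic_add_subproof a b : `[< coherent (padic_add_seq a b) >].
Proof.
apply/asboolP => n; rewrite /padic_add_seq !val_padicD !padic_mod_dvd //.
by rewrite -modnDm !padic_intP modnDm.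
Qed.

Lemma padic_opp_subproof a : `[< coherent (padic_opp_seq a) >].
Proof.
apply/asboolP => n; rewrite /padic_opp_seq !val_padicN !padic_mod_dvd //.
have le_a k : (a k <= p ^ k.+1)%N by exact/ltnW/padic_ltn.
apply/eqP; rewrite -(eqn_modDr (a n.+1)) subnK //.
rewrite -modnDmr padic_intP modnDmr subnK //.
by rewrite [X in (_ == X)%N]modnn expnS modnMl.
Qed.

Lemma padic_mul_subproof a b : `[< coherent (padic_mul_seq a b) >].
Proof.
apply/asboolP => n; rewrite /padic_mul_seq !val_padicM !padic_mod_dvd //.
by rewrite -modnMm !padic_intP modnMm.
Qed.

Definition padic_nat k : Z_p := PadicInt hp (padic_const_subproof k).
Definition padic_add a b : Z_p := PadicInt hp (padic_add_subproof a b).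
Definition padic_opp a : Z_p := PadicInt hp (padic_opp_subproof a).
Definition padic_mul a b : Z_p := PadicInt hp (padic_mul_subproof a b).

Lemma padic_addA : associative padic_add.
Proof. by move=> a b c; apply: padic_ext => n; apply: addrA. Qed.
Lemma padic_addC : commutative padic_add.
Proof. by move=> a b; apply: padic_ext => n; apply: addrC. Qed.
Lemma padic_add0 : left_id (padic_nat 0) padic_add.
Proof. by move=> a; apply: padic_ext => n; apply: add0r. Qed.
Lemma padic_addN : left_inverse (padic_nat 0) padic_opp padic_add.
Proof. by move=> a; apply: padic_ext => n; apply: addNr. Qed.
Lemma padic_mulA : associative padic_mul.
Proof. by move=> a b c; apply: padic_ext => n; apply: mulrA. Qed.
Lemma padic_mulC : commutative padic_mul.
Proof. by move=> a b; apply: padic_ext => n; apply: mulrC. Qed.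
Lemma padic_mul1 : left_id (padic_nat 1) padic_mul.
Proof. by move=> a; apply: padic_ext => n; apply: mul1r. Qed.
Lemma padic_mulD : left_distributive padic_mul padic_add.
Proof. by move=> a b c; apply: padic_ext => n; apply: mulrDl. Qed.
Lemma padic_1neq0 : padic_nat 1 != padic_nat 0.
Proof.
apply/eqP => /(congr1 (fun a : Z_p => a 0)) /= /eqP.
by rewrite /padic_const oner_eq0.
Qed.

HB.instance Definition _ := GRing.isZmodule.Build Z_p
  padic_addA padic_addC padic_add0 padic_addN.
HB.instance Definition _ := GRing.Zmodule_isComNzRing.Build Z_p
  padic_mulA padic_mulC padic_mul1 padic_mulD padic_1neq0.

Lemma padic_seq0 n : (0 : Z_p) n = 0. Proof. by []. Qed.
Lemma padic_seq1 n : (1 : Z_p) n = 1. Proof. by []. Qed.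
Lemma padic_seqD a b n : (a + b) n = a n + b n. Proof. by []. Qed.
Lemma padic_seqN a n : (- a) n = - a n. Proof. by []. Qed.
Lemma padic_seqM a b n : (a * b) n = a n * b n. Proof. by []. Qed.

Definition padic_unit : {pred Z_p} := fun a => `[< exists b, b * a = 1 >].
Definition padic_inv a : Z_p :=
  if pselect (exists b, b * a = 1) is left h then projT1 (cid h) else a.

Lemma padic_mulVx : {in padic_unit, left_inverse 1 padic_inv *%R}.
Proof.
move=> a /asboolP ua; rewrite /padic_inv; case: pselect => // h.
by case: (cid h).
Qed.
Lemma padic_unitPl a b : b * a = 1 -> padic_unit a.
Proof. by move=> ba1; apply/asboolP; exists b. Qed.
Lemma padic_invr_out : {in [predC padic_unit], padic_inv =1 id}.
Proof.
by move=> a /asboolP nua; rewrite /padic_inv; case: pselect.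
Qed.

HB.instance Definition _ := GRing.ComNzRing_hasMulInverse.Build Z_p
  padic_mulVx padic_unitPl padic_invr_out.

Lemma padic_neq0 a : a != 0 -> exists n, a n != 0.
Proof.
move=> /eqP a_neq0; apply: contrapT => az; apply: a_neq0.
apply: padic_ext => n; apply: contrapT => /eqP an; apply: az; by exists n.
Qed.

(* v_p on Z_p: the least n such that a is nonzero modulo p^(n+1) is the
   largest n such that p^n divides a. *)
Definition padic_int_val a : \bar int :=
  if pselect (exists n, a n != 0) is left h then ((ex_minn h)%:Z)%:E%E
  else +oo%E.

Lemma padic_seq_modE a m n : (m <= n)%N -> a n = a m %[mod p ^ m.+1].
Proof.
elim: n => [|n IHn]; first by rewrite leqn0 => /eqP ->.
rewrite leq_eqVlt => /predU1P[-> //|]; rewrite ltnS => le_mn.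
rewrite -(IHn le_mn) -[LHS](@padic_mod_dvd m.+1 n.+1) //.
by rewrite padic_intP padic_mod_dvd.
Qed.

Lemma padic_seq_eq0 a n : (a n == 0) = (p ^ n.+1 %| a n)%N.
Proof.
by rewrite -val_eqE /= /dvdn modn_small ?padic_ltn.
Qed.

Lemma padic_seq_eq0S a m n : (m <= n)%N -> (a m == 0) = (p ^ m.+1 %| a n)%N.
Proof. by move=> mn; rewrite padic_seq_eq0 /dvdn (padic_seq_modE a mn). Qed.

Lemma padic_seqM_eq0 a b n : ((a * b) n == 0) = (p ^ n.+1 %| a n * b n)%N.
Proof. by rewrite padic_seqM -val_eqE [val _]val_padicM. Qed.

Lemma padic_integral a b : a * b = 0 -> (a == 0) || (b == 0).
Proof.
move=> ab0; apply: contraT; rewrite negb_or.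
case/andP => /padic_neq0[m am] /padic_neq0[n bn].
have le_mN : (m <= m + n.+1)%N by rewrite leq_addr.
have le_nN : (n <= m + n.+1)%N by rewrite addnS -addSn leq_addl.
have : (a * b) (m + n.+1)%N == 0 by rewrite ab0.
move: am bn; rewrite padic_seqM_eq0.
rewrite (padic_seq_eq0S a le_mN) (padic_seq_eq0S b le_nN).
move: (nat_of_ord _) (nat_of_ord _) => v u.
have [-> | u_gt0] := posnP u; first by rewrite dvdn0.
have [-> | v_gt0] := posnP v; first by rewrite dvdn0.
have uv_gt0 : (0 < u * v)%N by rewrite muln_gt0 u_gt0.
rewrite !pfactor_dvdn // -!leqNgt => um vn; rewrite lognM // => uv.
by have := leq_trans uv (leq_add um vn); rewrite addnS ltnNge leqnSn.
Qed.

HB.instance Definition _ := GRing.ComUnitRing_isIntegral.Build Z_p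
  padic_integral.

End PadicIntRing.

(* Extension of a valuation w of R to its field of fractions:
   w(n/d) = w(n) - w(d); it does not depend on the representative n/d as soon
   as w is additive on products. *)
Definition frac_val (R : idomainType) (w : R -> \bar int) (f : {fraction R}) :
  \bar int := (w (\n_(repr f)) - w (\d_(repr f)))%E.

Section GaussValuation.
Variables (p : nat) (hp : prime p).

Definition Qp : fieldType := {fraction padic_int hp}.

Definition padic_val : Qp -> \bar int := frac_val (@padic_int_val p hp).

Definition Qpx : fieldType := {fraction {poly Qp}}.

Definition indet : Qpx := tofrac 'X.

Definition gauss_poly_val (f : {poly Qp}) : \bar int :=
  \big[mine/+oo%E]_(j < size f) padic_val f`_j.

Definition gauss_val : Qpx -> \bar int := frac_val gauss_poly_val.

Definition gauss_ring : {pred Qpx} := fun f => (0 <= gauss_val f)%E.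

(* The congruence A = B mod p^n is only meaningful for A and B in Qp(x); for
   elements of an extension L it thus includes that A and B lie in (the image
   of) Qp(x). *)
Definition gauss_congr (L : fieldExtType Qpx) (n : nat) (A B : L) : Prop :=
  exists a b : Qpx, [/\ A = a%:A, B = b%:A &
    exists2 f, f \in gauss_ring & a - b = p%:R ^+ n * f].

End GaussValuation.

Definition truncated_log (p : nat) (L : fieldType) (t : L) : L :=
  \sum_(1 <= k < p) t ^+ k / k%:R.

(* Main.v *)
From HB Require Import structures.
Require Import Defs.
From mathcomp Require Import all_boot all_order all_algebra all_field.
From mathcomp Require Import boolp constructive_ereal.
From mathcomp Require Import ring zify.
Set Implicit Arguments.
Unset Strict Implicit.
Unset Printing Implicit Defensive.
Import Order.TTheory GRing.Theory Num.Theory.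
Local Open Scope ring_scope.

(** Put y_i = 1/(1 - c_i) and w = (-1)^(r-1) x. Substituting c = 1 - 1/y turns
    the equation of the c_i into y (y - 1)^(r-1) = w, which is monic in y with
    coefficients in Z[x]: the y_i are integral over Z[x]. Since
    c_i = (y_i - 1) / y_i, the summands on the right are
      L_1(c_i) / (1 - c_i)^p = sum_(0 < k < p) (y_i - 1)^k y_i^(p - k) / k,
    where L_1 is the truncated logarithm. They are polynomials in y_i over
    Z_(p), so both sides of the congruence lie in Z_(p)[x], and it suffices to
    find their difference in p Z_(p)[x].

    Because 1/k is congruent to (-1)^(k-1) binom(p, k) / p modulo p, the binomial
    formula for (y_i - (y_i - 1))^p = 1 gives, modulo p,
      L_1(c_i) / (1 - c_i)^p = (y_i^p - (y_i - 1)^p - 1) / p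
    ([homogenized_log]; the error term is p times a polynomial in y_i, whose sum
    over i is in Z_(p)[x] by Newton's identities, [power_sum_integral]).

    The sums of p-th powers are computed exactly. One has
      prod (1 - y_i T) = (1 - T)^(r-1) - w T^r,
      prod (1 - (y_i - 1) T) = (1 + T) - w T^r,
    and the coefficient of T^p in the logarithm of such a product is minus the
    sum of p-th powers divided by p; expanding the logarithm of the right-hand
    side gives closed formulas with terms w^k / k times a binomial coefficient
    ([power_sum_trinomial]). Reduced modulo p, the two binomial coefficients
    become - binom(rk - 1, k) and binom(rk - 1, k - 1) up to the sign
    (-1)^((r-1)k) that w^k carries, and Pascal's rule merges them into
    binom(rk, k) ([trinomial_bin_modp]).

    It remains to see that the elements of Z_p[x] have Gauss valuation at
    least 0 ([intpoly_gauss_ring]). *)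

(** * Truncated power series and the logarithm *)

Section TruncatedSeries.
Variable F : fieldType.
Implicit Types (f g h u : {poly F}) (n : nat).

Lemma coef0_exp f n : (f ^+ n)`_0 = f`_0 ^+ n.
Proof. by rewrite -!horner_coef0 horner_exp. Qed.

Lemma linear_coef0 a : (1 - a *: 'X : {poly F})`_0 = 1.
Proof. by rewrite coefB coef1 coefZ coefX mulr0 subr0. Qed.

(** Polynomials modulo X^n stand for power series truncated at order n. *)
Definition eqmodX n f g := 'X^n %| f - g.

Lemma dvdXnP n f : reflect (forall i, (i < n)%N -> f`_i = 0) ('X^n %| f).
Proof.
apply: (iffP idP) => [/dvdpP[q ->] i ltin | f0]; first by rewrite coefMXn ltin.
rewrite -(poly_take_drop n f) (_ : take_poly n f = 0) ?add0r ?dvdp_mull //.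
by apply/polyP => i; rewrite coef_take_poly coef0; case: ifP => // /f0.
Qed.

Lemma eqmodXP n f g : reflect (forall i, (i < n)%N -> f`_i = g`_i) (eqmodX n f g).
Proof.
apply: (iffP (dvdXnP _ _)) => fg i /fg; rewrite coefB => /eqP.
  by rewrite subr_eq0 => /eqP.
by move=> /eqP ->; rewrite subrr.
Qed.

Lemma eqmodX_refl n f : eqmodX n f f. Proof. exact/eqmodXP. Qed.
Lemma eqmodX_sym n f g : eqmodX n f g -> eqmodX n g f.
Proof. by move/eqmodXP=> fg; apply/eqmodXP => i /fg. Qed.
Lemma eqmodX_trans n g f h : eqmodX n f g -> eqmodX n g h -> eqmodX n f h.
Proof.
by move=> /eqmodXP fg /eqmodXP gh; apply/eqmodXP => i lt; rewrite fg ?gh.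
Qed.
Lemma eqmodXD n f g f' g' :
  eqmodX n f g -> eqmodX n f' g' -> eqmodX n (f + f') (g + g').
Proof.
by move=> /eqmodXP fg /eqmodXP fg'; apply/eqmodXP => i lt; rewrite !coefD fg ?fg'.
Qed.
Lemma eqmodXZ n c f g : eqmodX n f g -> eqmodX n (c *: f) (c *: g).
Proof. by move=> /eqmodXP fg; apply/eqmodXP => i lt; rewrite !coefZ fg. Qed.
Lemma eqmodXN n f g : eqmodX n f g -> eqmodX n (- f) (- g).
Proof. by rewrite -!scaleN1r; apply: eqmodXZ. Qed.
Lemma eqmodXMl n h f g : eqmodX n f g -> eqmodX n (h * f) (h * g).
Proof. by rewrite /eqmodX -mulrBr; apply: dvdp_mull. Qed.
Lemma eqmodXM n f g f' g' :
  eqmodX n f g -> eqmodX n f' g' -> eqmodX n (f * f') (g * g').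
Proof.
move=> fg fg'; apply: (eqmodX_trans (eqmodXMl f fg')).
by rewrite ![_ * g']mulrC; apply: eqmodXMl.
Qed.
Lemma eqmodX_exp n k f g : eqmodX n f g -> eqmodX n (f ^+ k) (g ^+ k).
Proof.
by move=> fg; elim: k => [|k IH]; rewrite ?eqmodX_refl // !exprS; apply: eqmodXM.
Qed.
Lemma eqmodX_sum n (I : Type) (s : seq I) (P : pred I) (f g : I -> {poly F}) :
  (forall i, P i -> eqmodX n (f i) (g i)) ->
  eqmodX n (\sum_(i <- s | P i) f i) (\sum_(i <- s | P i) g i).
Proof.
move=> fg; elim/big_rec2: _ => [|i g' f' Pi IH]; first exact: eqmodX_refl.
exact: eqmodXD (fg i Pi) IH.
Qed.
(** A polynomial with constant term 1 is invertible modulo X^n. *)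
Lemma eqmodX_cancel n h f g : h`_0 = 1 -> eqmodX n (h * f) (h * g) -> eqmodX n f g.
Proof.
move=> h0; rewrite /eqmodX -mulrBr Gauss_dvdpr //.
rewrite coprimep_sym coprimep_expr // -['X]subr0 -polyC0.
by rewrite coprimep_XsubC /root horner_coef0 h0 oner_eq0.
Qed.

Hypothesis F0 : [pchar F] =i pred0.

Lemma natr_eq0_pchar0 n : (n%:R == 0 :> F) = (n == 0%N).
Proof. exact: (pcharf0P F).1. Qed.

(** Integration gains one order of precision: this is what lets identities
    between logarithms be checked on logarithmic derivatives. *)
Lemma eqmodX_primitive n f g :
  f`_0 = g`_0 -> eqmodX n f^`() g^`() -> eqmodX n.+1 f g.
Proof.
move=> fg0 /eqmodXP fg; apply/eqmodXP => -[//|i] /fg; rewrite !coef_deriv.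
by rewrite -[LHS]mulr_natr -[RHS]mulr_natr; apply: mulIf; rewrite natr_eq0_pchar0.
Qed.

Section Log.
Variable N : nat.

(** The series of log f in powers of 1 - f, where f has constant term 1, cut
    after the N-th power. *)
Definition log_trunc f := - \sum_(1 <= k < N.+1) k%:R^-1 *: (1 - f) ^+ k.

(** The derivative of the sum is f' times a geometric sum in 1 - f, which is an
    inverse of f up to (1 - f)^N, a multiple of X^N. *)
Lemma log_trunc_deriv f : f`_0 = 1 -> eqmodX N (f * (log_trunc f)^`()) f^`().
Proof.
move=> f0.
have -> : (log_trunc f)^`() = f^`() * \sum_(k < N) (1 - f) ^+ k.
  rewrite /log_trunc derivN raddf_sum -sumrN big_add1 /= big_mkord mulr_sumr.
  apply: eq_bigr => k _; rewrite derivZ deriv_exp derivB derivC sub0r /=.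
  rewrite mulNr mulNrn scalerN opprK.
  by rewrite -[X in _ *: X = _]scaler_nat scalerA mulVf ?natr_eq0_pchar0 // scale1r.
have -> : f * (f^`() * \sum_(k < N) (1 - f) ^+ k)
        = f^`() - f^`() * (1 - f) ^+ N.
  have := subrX1 (1 - f) N; set S := \sum_(_ < N) _ => e.
  have -> : (1 - f) ^+ N = 1 - f * S by rewrite -[LHS](subrK 1) e; ring.
  ring.
rewrite /eqmodX (_ : _ - _ = - f^`() * (1 - f) ^+ N); last by ring.
apply/dvdp_mull/dvdp_exp2r; rewrite -['X]expr1; apply/dvdXnP => -[] // _.
by rewrite coefB coef1 f0 subrr.
Qed.

Lemma log_trunc_coef0 f : f`_0 = 1 -> (log_trunc f)`_0 = 0.
Proof.
move=> f0; rewrite coefN coef_sum big_nat big1 ?oppr0 // => k /andP[k0 _].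
by rewrite coefZ coef0_exp coefB coef1 f0 subrr expr0n gtn_eqF // mulr0.
Qed.

Lemma log_trunc1 : log_trunc 1 = 0.
Proof.
rewrite /log_trunc subrr big_nat big1 ?oppr0 // => k /andP[k0 _].
by rewrite expr0n gtn_eqF // scaler0.
Qed.

Lemma eqmodX_log_trunc n f g : eqmodX n f g -> eqmodX n (log_trunc f) (log_trunc g).
Proof.
move=> fg; apply/eqmodXN/eqmodX_sum => k _; apply/eqmodXZ/eqmodX_exp.
by apply: eqmodXD; [exact: eqmodX_refl | exact: eqmodXN].
Qed.

(** Both sides have the same logarithmic derivative. *)
Lemma log_truncM f g : f`_0 = 1 -> g`_0 = 1 ->
  eqmodX N.+1 (log_trunc (f * g)) (log_trunc f + log_trunc g).
Proof.
move=> f0 g0; have fg0 : (f * g)`_0 = 1 by rewrite coef0M f0 g0 mulr1.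
apply: eqmodX_primitive; first by rewrite coefD !log_trunc_coef0 // addr0.
apply: (eqmodX_cancel fg0); apply: (eqmodX_trans (log_trunc_deriv fg0)).
rewrite derivM derivD (_ : f * g * _ = f * (log_trunc f)^`() * g
  + f * (g * (log_trunc g)^`())); last by ring.
apply/eqmodX_sym/eqmodXD; last by apply: eqmodXMl; apply: log_trunc_deriv.
by apply: eqmodXM; [exact: log_trunc_deriv | exact: eqmodX_refl].
Qed.

Lemma prod_coef0 (I : Type) (s : seq I) (f : I -> {poly F}) :
  (forall i, (f i)`_0 = 1) -> (\prod_(i <- s) f i)`_0 = 1.
Proof.
move=> f0; elim/big_rec: _ => [|i g _ g0]; first by rewrite coef1.
by rewrite coef0M f0 g0 mulr1.
Qed.

Lemma log_trunc_prod (I : Type) (s : seq I) (f : I -> {poly F}) :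
  (forall i, (f i)`_0 = 1) ->
  eqmodX N.+1 (log_trunc (\prod_(i <- s) f i)) (\sum_(i <- s) log_trunc (f i)).
Proof.
move=> f0; elim: s => [|i s IH]; first by rewrite !big_nil log_trunc1 eqmodX_refl.
rewrite !big_cons; apply: (eqmodX_trans (log_truncM (f0 i) (prod_coef0 s f0))).
by apply: eqmodXD; rewrite ?eqmodX_refl.
Qed.

Lemma log_trunc_exp f m : f`_0 = 1 ->
  eqmodX N.+1 (log_trunc (f ^+ m)) (log_trunc f *+ m).
Proof.
move=> f0; have := @log_trunc_prod _ (index_enum 'I_m) (fun=> f) (fun=> f0).
by rewrite prodr_const sumr_const card_ord.
Qed.

Lemma log_trunc_linear_coef a : (0 < N)%N ->
  (log_trunc (1 - a *: 'X))`_N = - (a ^+ N / N%:R).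
Proof.
move=> N0; rewrite coefN coef_sum big_nat_recr //= big_nat big1 => [|k /andP[_ kN]].
  by rewrite add0r opprB addrC subrK coefZ exprZn coefZ coefXn eqxx mulr1 mulrC.
by rewrite opprB addrC subrK exprZn !coefZ coefXn gtn_eqF // !mulr0.
Qed.

End Log.

Definition geom_trunc n a : {poly F} := \sum_(j < n) (a *: 'X) ^+ j.

Lemma geom_truncP n a : eqmodX n ((1 - a *: 'X) * geom_trunc n a) 1.
Proof.
rewrite /eqmodX (_ : _ - _ = - (a *: 'X) ^+ n); last first.
  by rewrite -[1 - a *: 'X]opprB mulNr -subrX1 opprB addrAC subrr add0r.
by rewrite -mulN1r exprZn -mul_polyC !dvdp_mull.
Qed.

Lemma geom_trunc_exp_coef n a M j : (j < n)%N ->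
  (geom_trunc n a ^+ M)`_j = a ^+ j * 'C((j + M).-1, j)%:R.
Proof.
elim: M j => [|M IH] j.
  by case: j => [|j] _; rewrite coef1 ?mulr1 // addn0 bin_small ?mulr0.
elim: j => [|j IHj] jn.
  rewrite bin0 mulr1 expr0 coef0_exp coef_sum (bigD1 (Ordinal jn)) //=.
  rewrite coef1 big1 ?addr0 ?expr1n // => -[[|i] //= ? _].
  by rewrite exprZn coefZ coefXn mulr0.
have /eqmodXP/(_ _ jn) : eqmodX n
    ((1 - a *: 'X) * geom_trunc n a ^+ M.+1) (geom_trunc n a ^+ M).
  rewrite exprS mulrA -[X in eqmodX _ _ X]mul1r.
  by apply: eqmodXM; [exact: geom_truncP | exact: eqmodX_refl].
rewrite mulrBl mul1r coefB -scalerAl coefZ coefXM /= IH // IHj 1?ltnW // => /eqP.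
rewrite subr_eq => /eqP ->; rewrite !addnS addSn /= binS natrD exprS.
by rewrite mulrA mulrDr.
Qed.

(** Factor the right-hand side as (1 - a X)^m (1 - u), with
    u = w X^r (1 - a X)^(-m), and compare the coefficients of X^n in the logarithms of the two sides: u^k / k
    contributes through the coefficient of X^(n - rk) in (1 - a X)^(-mk). When
    n = rk and m = 0 the truncated predecessor gives binom(0, 0) = 1, as it
    should. *)
Theorem power_sum_trinomial (I : finType) (z : I -> F) a w m r n :
    (0 < r)%N -> (0 < n)%N ->
    \prod_i (1 - z i *: 'X) = (1 - a *: 'X) ^+ m - w *: 'X^r ->
  (\sum_i z i ^+ n) / n%:R = m%:R * a ^+ n / n%:R
    + \sum_(1 <= k < n.+1 | (r * k <= n)%N)
        w ^+ k / k%:R *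
          (a ^+ (n - r * k) * 'C((n - r * k + m * k).-1, n - r * k)%:R).
Proof.
move=> r0 n0 prodE; pose s := geom_trunc n.+1 a; pose u := w *: ('X^r * s ^+ m).
have u0 : (1 - u)`_0 = 1 by rewrite coefB coef1 coefZ coefXnM r0 mulr0 subr0.
have factE : eqmodX n.+1 ((1 - a *: 'X) ^+ m - w *: 'X^r)
    ((1 - a *: 'X) ^+ m * (1 - u)).
  rewrite mulrBr mulr1; apply/eqmodXD; [exact: eqmodX_refl | apply: eqmodXN].
  rewrite -scalerAr mulrCA -exprMn; apply: eqmodXZ.
  rewrite -[X in eqmodX _ X]mulr1; apply: eqmodXMl; apply: eqmodX_sym.
  by rewrite -[X in eqmodX _ _ X](expr1n _ m); apply/eqmodX_exp/geom_truncP.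
have : eqmodX n.+1 (\sum_i log_trunc n (1 - z i *: 'X))
               (log_trunc n (1 - a *: 'X) *+ m + log_trunc n (1 - u)).
  have logE := log_trunc_prod n (index_enum I) (fun i => linear_coef0 (z i)).
  apply: eqmodX_trans (eqmodX_sym logE) _; rewrite prodE.
  apply: eqmodX_trans (eqmodX_log_trunc n factE) _.
  apply: eqmodX_trans (log_truncM n _ u0) _.
    by rewrite coef0_exp linear_coef0 expr1n.
  by apply: eqmodXD; [exact/log_trunc_exp/linear_coef0 | exact: eqmodX_refl].
move/eqmodXP/(_ n (leqnn _)); rewrite coefD coefMn coef_sum.
rewrite log_trunc_linear_coef //.
under eq_bigr do rewrite log_trunc_linear_coef //.
rewrite sumrN -mulr_suml => /(congr1 -%R); rewrite opprK => ->.
rewrite mulNrn opprD opprK -[X in X + _ = _]mulr_natl mulrA; congr (_ + _).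
rewrite coefN opprK opprB addrC subrK coef_sum [RHS]big_mkcond /=.
apply: eq_big_nat => k /andP[k1 kn]; rewrite coefZ exprZn coefZ exprMn -exprM.
rewrite coefXnM ltnNge; case: leqP => rk /=; last by rewrite !mulr0.
by rewrite -exprM geom_trunc_exp_coef ?ltnS ?leq_subr // mulrCA mulrA.
Qed.

(** Newton's identities: for h the product, the power sums are, up to sign and
    shift, the coefficients of h' / h, and division by a series with constant
    term 1 takes place inside S. *)
Theorem power_sum_integral (S : subringClosed F) (I : finType) (z : I -> F) :
  \prod_i (1 - z i *: 'X) \is a polyOver S -> forall n, \sum_i z i ^+ n \in S.
Proof.
set h := \prod_i _ => hS n.
have h0 : h`_0 = 1 by apply: prod_coef0 => i; apply: linear_coef0.
case: n => [|n].
  by under eq_bigr do rewrite expr0; rewrite sumr_const rpred_nat.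
pose D := (log_trunc n.+1 h)^`().
have DE : eqmodX n.+1 (h * D) h^`() by apply: log_trunc_deriv.
have DS i : (i <= n)%N -> D`_i \in S.
  (* solve h D = h' for the coefficient D_i in terms of the previous ones *)
  elim/ltn_ind: i => i IH lei; have /eqmodXP/(_ i lei) := DE.
  rewrite coefM big_ord_recl h0 mul1r subn0 => /eqP.
  rewrite -subr_eq0 -addrA addr_eq0 => /eqP ->.
  rewrite rpredN rpredB //.
    apply: rpred_sum => j _; apply: rpredM; first exact/polyOverP.
    rewrite lift0; apply: IH; last exact: leq_trans (leq_subr _ _) lei.
    by rewrite ltn_subrL /= (leq_ltn_trans _ (ltn_ord j)).
  by rewrite coef_deriv rpredMn //; apply/polyOverP.
have : D`_n = - \sum_i z i ^+ n.+1.
  have /eqmodXP/(_ n.+1 (leqnn _)) :=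
    log_trunc_prod n.+1 (index_enum I) (fun i => linear_coef0 (z i)).
  rewrite -/h /D coef_deriv => ->; rewrite coef_sum.
  under eq_bigr do rewrite log_trunc_linear_coef //.
  by rewrite sumrN -mulr_suml mulNrn -[X in - X]mulr_natr mulfVK ?natr_eq0_pchar0.
by move/eqP; rewrite -eqr_oppLR => /eqP <-; rewrite rpredN DS.
Qed.

End TruncatedSeries.

(** * Binomial coefficients modulo p *)

Section BinomialCongruences.
Variables (p : nat) (hp : prime p).

(** Modulo p the top entry p - 1 - a is -(a + 1), and this is the reflection
    binom(-(a + 1), m) = (-1)^m binom(a + m, m). *)
Lemma bin_reflection_modp a m : (a + m < p)%N ->
  'C(p.-1 - a, m)%:R = (-1) ^+ m * 'C(a + m, m)%:R :> 'F_p.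
Proof.
elim: m => [|m IH] amp; first by rewrite !bin0 mulr1.
have m0 : m.+1%:R != 0 :> 'F_p.
  rewrite -(dvdn_pcharf (pchar_Fp hp)) gtnNdvd //.
  by apply: leq_trans amp; rewrite ltnS leq_addl.
apply: (mulfI m0); rewrite -natrM mul_bin_left natrM IH; last by lia.
rewrite [RHS]mulrCA -[m.+1%:R * _]natrM -mul_bin_diag addnS /= natrM.
have -> : (p.-1 - a - m)%:R = - (a + m).+1%:R :> 'F_p.
  apply/eqP; rewrite -addr_eq0 -natrD (_ : _ + _ = p)%N; last by lia.
  by rewrite -(dvdn_pcharf (pchar_Fp hp)).
by rewrite exprS; ring.
Qed.

Lemma dvdz_Fp (z : int) : (p %| z)%Z = (z%:~R == 0 :> 'F_p).
Proof.
case: z => n; rewrite ?NegzE ?dvdzN ?mulrNz ?oppr_eq0;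
  exact: dvdn_pcharf (pchar_Fp hp) _.
Qed.

(** The case a = 0 of the reflection: binom(p - 1, k - 1) is (-1)^(k-1) mod p. *)
Lemma pred_bin_modp k : (0 < k < p)%N ->
  (p %| 1 - (-1) ^+ k.-1 * 'C(p.-1, k.-1)%:Z)%Z.
Proof.
move=> k0p; rewrite dvdz_Fp rmorphB rmorphM rmorphXn rmorphN !rmorph1 /= -pmulrn.
have := @bin_reflection_modp 0 k.-1.
rewrite subn0 add0n binn mulr1 => ->; last by lia.
by rewrite -exprMn mulrNN mulr1 expr1n subrr.
Qed.

(** The difference, in degree p, of the terms of index k that
    [power_sum_trinomial] produces for the y_i (a = 1, m = r - 1) and for the
    y_i - 1 (a = -1, m = 1), with the sign of w^k included. *)
Definition trinomial_bin r k : int :=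
  (-1) ^+ (r.-1 * k) * ('C((p - r * k + r.-1 * k).-1, p - r * k)%:Z
     - (-1) ^+ (p - r * k) * 'C((p - r * k + k).-1, p - r * k)%:Z).

(** Rewritten by symmetry as binom(p - 1 - k, (r-1)k - 1) and
    binom(p - 1 - (r-1)k, k - 1), the two binomial coefficients reflect to
    binom(rk - 1, k) and binom(rk - 1, k - 1), and the total vanishes by Pascal's
    rule. *)
Lemma trinomial_bin_modp r k : odd p -> (0 < r)%N -> (0 < k)%N -> (r * k < p)%N ->
  (p %| trinomial_bin r k + 'C(r * k, k)%:Z)%Z.
Proof.
case: r => // r p_odd _ k0; rewrite /trinomial_bin succnK mulSn => rkp.
rewrite dvdz_Fp rmorphD rmorphM rmorphB rmorphM !rmorphXn rmorphN rmorph1 /=.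
rewrite -!pmulrn; set n := (p - _)%N.
have C2 : 'C((n + k).-1, n)%:R = (-1) ^+ k.-1 * 'C((k + r * k).-1, k.-1)%:R :> 'F_p.
  have -> : ((n + k).-1 = p.-1 - r * k)%N by rewrite /n; lia.
  rewrite -bin_sub; last by rewrite /n; lia.
  have -> : (p.-1 - r * k - n = k.-1)%N by rewrite /n; lia.
  rewrite bin_reflection_modp; last by lia.
  by rewrite (_ : r * k + k.-1 = (k + r * k).-1)%N; last by lia.
have C1 : (-1) ^+ (r * k) * 'C((n + r * k).-1, n)%:R
    = - 'C((k + r * k).-1, k)%:R :> 'F_p.
  (* k is positive, so r = 0 and both binomial coefficients vanish *)
  have [rk0|rk0] := posnP (r * k).
    by rewrite rk0 !addn0 !bin_small ?mulr0 ?oppr0 // /n; lia.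
  have -> : ((n + r * k).-1 = p.-1 - k)%N by rewrite /n; lia.
  rewrite -bin_sub; last by rewrite /n; lia.
  have -> : (p.-1 - k - n = (r * k).-1)%N by rewrite /n; lia.
  rewrite bin_reflection_modp; last by lia.
  rewrite (_ : k + (r * k).-1 = (k + r * k).-1)%N; last by lia.
  rewrite -['C(_, (r * k).-1)]bin_sub; last by lia.
  rewrite (_ : (k + r * k).-1 - (r * k).-1 = k)%N; last by lia.
  rewrite mulrA -exprD -signr_odd (_ : odd _ = true) ?expr1 ?mulN1r //.
  by rewrite -[in X in odd X](prednK rk0) addSn /= addnn odd_double.
rewrite mulrBr C1 C2.
have -> : (-1) ^+ (r * k) *
      ((-1) ^+ n * ((-1) ^+ k.-1 * 'C((k + r * k).-1, k.-1)%:R))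
    = 'C((k + r * k).-1, k.-1)%:R :> 'F_p.
  rewrite !mulrA -!exprD (_ : (r * k + n + k.-1)%N = p.-1); last by rewrite /n; lia.
  (* the signs add up to the even exponent p - 1 *)
  rewrite -signr_odd (_ : odd _ = false) ?mul1r //.
  by move: p_odd; rewrite -{1}(prednK (prime_gt0 hp)) => /negbTE.
have [K ->] : exists K, k = K.+1 by exists k.-1; rewrite prednK.
by rewrite addSn /= binS natrD -opprD addNr.
Qed.

End BinomialCongruences.

(** * The p-adic and Gauss valuations *)

Lemma frac_numden (R : idomainType) (f : {fraction R}) :
  f = FracField.tofrac (\n_(repr f)) / FracField.tofrac (\d_(repr f)).
Proof.
have d0 : FracField.tofrac (\d_(repr f)) != 0 by rewrite tofrac_eq0 denom_ratioP.
apply: (mulIf d0); rewrite mulfVK // -[f in LHS]reprK.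
unlock FracField.tofrac; rewrite -[LHS]FracField.pi_mul; apply/eqmodP.
rewrite reprK /= /FracField.equivf /FracField.mulf !numden_Ratio;
  by rewrite ?mulr1 ?oner_eq0 ?denom_ratioP // mulrC.
Qed.

Lemma fracP (R : idomainType) (f : {fraction R}) :
  exists n, exists2 d, d != 0 & f = FracField.tofrac n / FracField.tofrac d.
Proof.
by exists (\n_(repr f)), (\d_(repr f)); [exact: denom_ratioP | exact: frac_numden].
Qed.

Section PadicValuation.
Variables (p : nat) (hp : prime p).
Local Notation Zp := (padic_int hp).
Local Notation v := (@padic_int_val p hp).
Implicit Types a b : Zp.

Lemma padic_int_val0 : v 0 = +oo%E.
Proof.
rewrite /padic_int_val; case: pselect => // -[n n0].
by exfalso; case/negP: n0.
Qed.

Variant padic_int_val_spec a : \bar int -> Prop :=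
  PadicIntVal n of a n != 0 & (forall m, (m < n)%N -> a m = 0) :
    padic_int_val_spec a (n%:Z)%:E%E.

Lemma padic_int_valP a : a != 0 -> padic_int_val_spec a (v a).
Proof.
move=> /padic_neq0 a0; rewrite /padic_int_val; case: pselect => // h.
case: ex_minnP => n an minn; constructor => // m mn.
by apply/eqP; apply: contraTT mn => /minn; rewrite -leqNgt.
Qed.

Lemma padic_int_val_eq a n :
  a n != 0 -> (forall m, (m < n)%N -> a m = 0) -> v a = (n%:Z)%:E%E.
Proof.
move=> an am; have a0 : a != 0 by apply: contraNneq an => ->.
case: (padic_int_valP a0) => k ak aj; congr (_%:Z)%:E%E.
by case: (ltngtP k n) => // [/am|/aj] e; [move: ak | move: an]; rewrite e eqxx.
Qed.

Lemma padic_seq_unit a n : a 0 != 0 -> a n \is a GRing.unit.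
Proof.
move=> a0; rewrite -[a n]natr_Zp unitZpE ?padic_pow_gt1 //.
by rewrite coprimeXl // prime_coprime // -(padic_seq_eq0S a (leq0n n)).
Qed.

(** The inverses modulo the powers of p are coherent, by uniqueness of inverses. *)
Lemma padic_unit_of_residue a : a 0 != 0 -> a \is a GRing.unit.
Proof.
move=> a0; pose b n := (a n)^-1.
have ab n : (a n * b n = 1 %[mod p ^ n.+1])%N.
  have := congr1 (@nat_of_ord _) (mulrV (padic_seq_unit n a0)).
  by rewrite val_padicM // => ->; rewrite [RHS]modn_small ?padic_pow_gt1.
have b_coherent : `[< coherent b >].
  apply/asboolP => n.
  have ab' : (a n * b n.+1 = 1 %[mod p ^ n.+1])%N.
    rewrite -modnMml -(padic_intP a n) modnMml.
    by rewrite -[LHS](@padic_mod_dvd p n.+1 n.+2) // ab padic_mod_dvd.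
  transitivity ((b n.+1 * (a n * b n)) %% p ^ n.+1)%N.
    by rewrite -modnMmr ab modnMmr muln1.
  by rewrite mulnA [(b n.+1 * a n)%N]mulnC -modnMml ab' modnMml mul1n.
apply/unitrP; exists (PadicInt hp b_coherent); split; apply: padic_ext => n.
  by rewrite padic_seqM mulVr ?padic_seq_unit.
by rewrite padic_seqM mulrV ?padic_seq_unit.
Qed.

(** The valuation can be read off any representative modulo a high enough power
    of p, which reduces multiplicativity to that of [logn]. *)
Lemma logn_padic_seq a n N :
    a n != 0 -> (forall m, (m < n)%N -> a m = 0) -> (n <= N)%N ->
  (0 < a N)%N /\ logn p (a N) = n.
Proof.
move=> an am nN; rewrite (padic_seq_eq0S a nN) in an.
have aN0 : (0 < a N)%N by case: posnP an => // ->; rewrite dvdn0.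
split=> //; apply/eqP; rewrite eqn_leq; apply/andP; split.
  by move: an; rewrite pfactor_dvdn // -ltnNge ltnS.
case: n am nN {an} => // n am nN; rewrite -pfactor_dvdn //.
by rewrite -(padic_seq_eq0S a (ltnW nN)) am.
Qed.

Lemma padic_int_valM a b : v (a * b) = (v a + v b)%E.
Proof.
have [->|a0] := eqVneq a 0.
  rewrite mul0r padic_int_val0; have [->|b0] := eqVneq b 0.
    by rewrite padic_int_val0.
  by case: (padic_int_valP b0).
have [->|b0] := eqVneq b 0.
  by rewrite mulr0 padic_int_val0; case: (padic_int_valP a0).
case: (padic_int_valP a0) => i ai am; case: (padic_int_valP b0) => j bj bm.
have [u0 ui] := logn_padic_seq ai am (leq_addr j i).
have [w0 wj] := logn_padic_seq bj bm (leq_addl i j).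
have abE m : (m <= i + j)%N -> ((a * b) m == 0) = (m.+1 <= i + j)%N.
  move=> mN; rewrite (padic_seq_eq0S _ mN) padic_seqM val_padicM //.
  rewrite [(_ %| _)%N]/dvdn padic_mod_dvd // -/(dvdn _ _).
  by rewrite pfactor_dvdn ?muln_gt0 ?u0 ?w0 // lognM // ui wj.
rewrite (@padic_int_val_eq _ (i + j)%N) ?abE ?ltnn //= => m mN.
by apply/eqP; rewrite abE // ltnW.
Qed.

Lemma padic_int_valD a b : (mine (v a) (v b) <= v (a + b)%R)%E.
Proof.
have [->|ab0] := eqVneq (a + b) 0; first by rewrite padic_int_val0 leey.
have [->|a0] := eqVneq a 0; first by rewrite add0r ge_min lexx orbT.
have [->|b0] := eqVneq b 0; first by rewrite addr0 ge_min lexx.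
rewrite ge_min; case: (padic_int_valP ab0) => n abn _.
case: (padic_int_valP a0) => i _ ai; case: (padic_int_valP b0) => j _ bj.
rewrite !lee_fin !lez_nat; apply: contraR abn; rewrite negb_or -!ltnNge.
by case/andP=> /ai an /bj bn; rewrite padic_seqD an bn addr0.
Qed.

End PadicValuation.

Section FractionValuation.
Variables (R : idomainType) (w : R -> \bar int).
Hypotheses (w0 : w 0 = +oo%E) (wfin : forall a, a != 0 -> w a \is a fin_num).
Hypothesis wM : forall a b, w (a * b) = (w a + w b)%E.
Local Notation vw := (frac_val w).
Local Notation "a %:F" := (FracField.tofrac a).

(** [frac_val] is computed on the chosen representative of a fraction;
    multiplicativity makes every representative give the same value. *)
Lemma frac_valE a d : d != 0 -> vw (a%:F / d%:F) = (w a - w d)%E.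
Proof.
move=> d0; rewrite /frac_val; set f := _ / _; set n := \n_ _; set e := \d_ _.
have e0 : e != 0 by exact: denom_ratioP.
have := congr1 (fun g => g * (d * e)%:F) (frac_numden f).
rewrite -/n -/e {1}/f rmorphM /= mulrA mulfVK ?tofrac_eq0 //.
rewrite mulrCA mulfVK ?tofrac_eq0 // -!rmorphM => /eqP.
rewrite tofrac_eq => /eqP /(congr1 w); rewrite !wM.
have := wfin e0; have := wfin d0.
case: (w d) => // ? _; case: (w e) => // ? _.
case: (w a) => [?||]; case: (w n) => [?||] //= [] ?; congr _%:E; lia.
Qed.

Lemma frac_val0 : vw 0 = +oo%E.
Proof.
rewrite -[0](mul0r (1%:F)^-1) -[X in X / _](rmorph0 (@FracField.tofrac R)).
rewrite frac_valE ?oner_eq0 // w0; have := wfin (oner_neq0 R).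
by case: (w 1).
Qed.

Lemma frac_val_fin f : f != 0 -> vw f \is a fin_num.
Proof.
move=> f0; rewrite /frac_val fin_numB.
apply/andP; split; apply: wfin; last exact: denom_ratioP.
by apply: contra_neq f0 => n0; rewrite (frac_numden f) n0 rmorph0 mul0r.
Qed.

Lemma frac_valM f g : vw (f * g) = (vw f + vw g)%E.
Proof.
have [n [d d0 ->]] := fracP f; have [n' [d' d'0 ->]] := fracP g.
rewrite mulrACA -invfM -!rmorphM !frac_valE ?mulf_neq0 // !wM.
have := wfin d'0; have := wfin d0.
case: (w d) => // ? _; case: (w d') => // ? _.
by case: (w n) => [?||]; case: (w n') => [?||] //=; congr _%:E; lia.
Qed.

Hypothesis wD : forall a b, (mine (w a) (w b) <= w (a + b)%R)%E.

Lemma frac_valD f g : (mine (vw f) (vw g) <= vw (f + g)%R)%E.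
Proof.
have [n [d d0 ->]] := fracP f; have [n' [d' d'0 ->]] := fracP g.
have -> : n%:F / d%:F + n'%:F / d'%:F = (n * d' + n' * d)%:F / (d * d')%:F.
  by rewrite addf_div ?tofrac_eq0 // -!rmorphM -rmorphD.
rewrite !frac_valE ?mulf_neq0 // wM.
have eqD (a b c : \bar int) : b \is a fin_num -> c \is a fin_num ->
    (a - b = a + c - (b + c))%E.
  by case: b c => [b||] [c||] // _ _; case: a => [a||] //=; congr _%:E; lia.
rewrite (eqD _ _ (w d')) ?wfin // (eqD (w n') _ (w d)) ?wfin //.
rewrite [(w d' + w d)%E]addeC ge_min; have := wD (n * d') (n' * d).
rewrite ge_min !wM => /orP[le_w|le_w]; apply/orP; [left|right]; exact: leeD2r.
Qed.

End FractionValuation.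

Section GaussIntegral.
Variables (p : nat) (hp : prime p).
Local Notation Zp := (padic_int hp).
Local Notation v := (@padic_val p hp).
Local Notation "a %:F" := (FracField.tofrac a).

Lemma padic_int_val_fin (a : Zp) : a != 0 -> padic_int_val a \is a fin_num.
Proof. by move=> a0; case: (padic_int_valP a0). Qed.

Lemma padic_int_val_ge0 (a : Zp) : (0 <= padic_int_val a)%E.
Proof.
have [->|a0] := eqVneq a 0; first by rewrite padic_int_val0.
by case: (padic_int_valP a0).
Qed.

Lemma padic_val0 : v 0 = +oo%E.
Proof.
exact: frac_val0 (@padic_int_val0 p hp) padic_int_val_fin (@padic_int_valM p hp).
Qed.

Lemma padic_val_fin a : a != 0 -> v a \is a fin_num.
Proof. exact: frac_val_fin padic_int_val_fin _. Qed.

Lemma padic_valM a b : v (a * b) = (v a + v b)%E.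
Proof. exact: frac_valM padic_int_val_fin (@padic_int_valM p hp) _ _. Qed.

Lemma padic_valD a b : (mine (v a) (v b) <= v (a + b)%R)%E.
Proof.
exact: frac_valD padic_int_val_fin (@padic_int_valM p hp)
  (@padic_int_valD p hp) _ _.
Qed.

Lemma padic_val_int_ge0 (a : Zp) : (0 <= v a%:F)%E.
Proof.
rewrite -[a%:F]divr1 -(rmorph1 (@FracField.tofrac Zp)) /padic_val.
rewrite (frac_valE (@padic_int_val_fin) (@padic_int_valM p hp)) ?oner_neq0 //.
by rewrite (@padic_int_val_eq _ _ 1 0) // sube0 padic_int_val_ge0.
Qed.

Lemma padic_val_sum (I : Type) (s : seq I) (P : pred I) (f : I -> Qp hp)
    (c : \bar int) :
  (forall i, P i -> (c <= v (f i))%E) -> (c <= v (\sum_(i <- s | P i) f i))%E.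
Proof.
move=> cf; elim/big_rec: _ => [|i x Pi cx]; first by rewrite padic_val0 leey.
by apply: le_trans (padic_valD _ _); rewrite le_min cf.
Qed.

Lemma gauss_poly_val_le (f : {poly Qp hp}) i : (gauss_poly_val f <= v f`_i)%E.
Proof.
have [fi|fi] := leqP (size f) i; first by rewrite nth_default // padic_val0 leey.
by rewrite /gauss_poly_val (bigD1 (Ordinal fi)) //= ge_min lexx.
Qed.

Definition intpoly_frac : {poly Zp} -> Qpx hp :=
  fun q => (map_poly (@FracField.tofrac Zp) q)%:F.

HB.instance Definition _ := GRing.RMorphism.copy intpoly_frac
  (@FracField.tofrac {poly Qp hp} \o map_poly (@FracField.tofrac Zp)).

(** For any fraction n / d equal to the polynomial q one has n = q d, and the
    ultrametric inequality on each coefficient of q d bounds the valuation of n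
    below by that of d. *)
Lemma intpoly_gauss_ring q : intpoly_frac q \in @gauss_ring p hp.
Proof.
rewrite unfold_in /gauss_val /frac_val; set f := intpoly_frac q.
set n := \n_ _; set d := \d_ _; have d0 : d != 0 by exact: denom_ratioP.
have nE : n = map_poly (@FracField.tofrac Zp) q * d.
  apply/eqP; rewrite -tofrac_eq rmorphM /= -[X in _ == X * _]/f {1}(frac_numden f).
  by rewrite mulfVK // tofrac_eq0.
have dfin : gauss_poly_val d \is a fin_num.
  rewrite fin_numE; apply/andP; split.
    rewrite /gauss_poly_val; elim/big_ind: _ => // [x y|i _].
      by rewrite /mine; case: ifP.
    have [->|di] := eqVneq d`_i 0; first by rewrite padic_val0.
    by have /fin_numP[] := padic_val_fin di.
  have /fin_numP[_] : v (lead_coef d) \is a fin_num.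
    by apply: padic_val_fin; rewrite lead_coef_eq0.
  by apply: contra_neq => e; apply/eqP; rewrite -leye_eq -e gauss_poly_val_le.
rewrite suber_ge0 // nE.
rewrite [leRHS]/gauss_poly_val; elim/big_ind: _ => [|x y ? ?|i _]; first exact: leey.
  by rewrite le_min; apply/andP.
rewrite coefM; apply: padic_val_sum => j _; rewrite coef_map padic_valM.
by apply: le_trans (leeDr _ (padic_val_int_ge0 _)); apply: gauss_poly_val_le.
Qed.

End GaussIntegral.

(** * The image of Z_p[x] in an extension of Q_p(x) *)

Section Integral.
Variables (p : nat) (hp : prime p) (L : fieldExtType (Qpx hp)).
Local Notation Zp := (padic_int hp).

Lemma padic_seq_nat k n : (k%:R : Zp) n = k%:R.
Proof. by elim: k => // k IH; rewrite !mulrSr padic_seqD IH. Qed.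

Lemma padic_int_pchar0 : [pchar Zp] =i pred0.
Proof.
apply/pcharf0P => n; apply/eqP/eqP => [n0|-> //].
apply/eqP; apply: contraT; rewrite -lt0n => n_gt0.
have := congr1 (fun a : Zp => a n == 0) n0; rewrite padic_seq_nat padic_seq0 eqxx.
rewrite -val_eqE /= val_Zp_nat ?padic_pow_gt1 // modn_small ?gtn_eqF //.
by apply: ltn_trans (ltn_expl _ (prime_gt1 hp)) _; rewrite ltn_exp2l ?prime_gt1.
Qed.

Lemma Qpx_ext_pchar0 : [pchar L] =i pred0.
Proof.
apply/pcharf0P => n.
rewrite -(rmorph_nat (in_alg L)) fmorph_eq0 -(rmorph_nat (@FracField.tofrac _)).
rewrite tofrac_eq0 -polyC_natr polyC_eq0 -(rmorph_nat (@FracField.tofrac _)).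
by rewrite tofrac_eq0 (pcharf0P _).1 //; apply: padic_int_pchar0.
Qed.

Definition intpoly_image : {pred L} :=
  fun z => `[< exists q, z = (@intpoly_frac p hp q)%:A >].

Lemma intpoly_imageP z :
  reflect (exists q, z = in_alg L (@intpoly_frac p hp q)) (z \in intpoly_image).
Proof. exact: asboolP. Qed.

Lemma intpoly_image_subring : subring_closed intpoly_image.
Proof.
split; first by apply/intpoly_imageP; exists 1; rewrite !rmorph1.
  move=> _ _ /intpoly_imageP[q ->] /intpoly_imageP[q' ->].
  by apply/intpoly_imageP; exists (q - q'); rewrite !rmorphB.
move=> _ _ /intpoly_imageP[q ->] /intpoly_imageP[q' ->].
by apply/intpoly_imageP; exists (q * q'); rewrite !rmorphM.
Qed.
HB.instance Definition _ :=
  GRing.isSubringClosed.Build L intpoly_image intpoly_image_subring.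

Lemma intpoly_image_indet : (indet hp)%:A \in intpoly_image.
Proof. by apply/intpoly_imageP; exists 'X; rewrite /intpoly_frac map_polyX. Qed.

Lemma intpoly_image_natV k : (0 < k < p)%N -> k%:R^-1 \in intpoly_image.
Proof.
move=> k0p; apply/intpoly_imageP; exists (k%:R^-1)%:P.
have kZp : (k%:R : Zp) \is a GRing.unit.
  apply: padic_unit_of_residue; rewrite padic_seq_nat -val_eqE /=.
  by rewrite val_Zp_nat ?expn1 ?prime_gt1 // modn_small; lia.
have k0 : k%:R != 0 :> L by rewrite (natr_eq0_pchar0 Qpx_ext_pchar0); lia.
have kE : in_alg L (@intpoly_frac p hp k%:R) = k%:R by rewrite !rmorph_nat.
apply: (mulfI k0); rewrite divff // -[X in _ = X * _]kE -!rmorphM.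
by rewrite -polyC_natr -polyCM divrr // !rmorph1.
Qed.

End Integral.

(** * The equation of the y_i *)

Section Roots.
Variables (K : fieldType) (r : nat) (x : K) (c : 'I_r -> K).
Hypothesis r0 : (0 < r)%N.
Hypothesis hc :
  x *: ('X - 1) ^+ r + 'X^(r.-1) = x *: \prod_(i < r) ('X - (c i)%:P).

(** Evaluate the factorization at A / B in the field of fractions of K[X] and
    multiply by B^r. *)
Lemma prod_root_homogenized (A B : {poly K}) : B != 0 ->
  x *: (A - B) ^+ r + B * A ^+ r.-1 = x *: \prod_(i < r) (A - c i *: B).
Proof.
move=> B0; pose F := {fraction {poly K}}.
pose T : {poly K} -> F := @FracField.tofrac {poly K}.
pose io : K -> F := T \o polyC.
have TB0 : T B != 0 by rewrite /T tofrac_eq0.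
have subE c0 : T (A - c0 *: B) = T B * (T A / T B - io c0).
  by rewrite mulrBr mulrCA divff // mulr1 /T rmorphB /= -mul_polyC rmorphM mulrC.
pose t := T A / T B.
have hF : io x * (t - 1) ^+ r + t ^+ r.-1 = io x * \prod_(i < r) (t - io (c i)).
  have := congr1 (fun q => (map_poly io q).[t]) hc.
  rewrite rmorphD /= !map_polyZ !rmorphXn rmorphB /= !map_polyX rmorph1 rmorph_prod.
  rewrite !hornerE horner_prod => ->; congr (_ * _); apply: eq_bigr => i _.
  by rewrite rmorphB /= map_polyX map_polyC !hornerE.
apply/eqP; rewrite -tofrac_eq -/T; apply/eqP.
rewrite -!(mul_polyC x) /T rmorphD !rmorphM !rmorphXn /= rmorph_prod -/T.
rewrite -[T x%:P]/(io x) (eq_bigr _ (fun i _ => subE (c i))).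
rewrite big_split prodr_const card_ord mulrCA /= -/t -hF.
rewrite (_ : T (A - B) = T B * (t - 1)); last first.
  by rewrite -[B in A - B]scale1r subE /io /= polyC1 /T rmorph1.
rewrite (_ : T A = T B * t); last by rewrite mulrCA divff // mulr1.
rewrite 2!exprMn mulrDr; congr (_ + _); first by rewrite mulrCA.
by rewrite mulrA -exprS prednK.
Qed.

Lemma prod_one_sub_root : x * \prod_(i < r) (1 - c i) = 1.
Proof.
have := congr1 (horner^~ 1) hc; rewrite /= !hornerE horner_prod subrr.
rewrite expr0n gtn_eqF // mulr0 add0r expr1n => oneE; rewrite [RHS]oneE.
by congr (_ * _); apply: eq_bigr => i _; rewrite !hornerE.
Qed.

Lemma one_sub_root_neq0 i : 1 - c i != 0.
Proof.
apply: contra_eq_neq prod_one_sub_root => ci.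
by rewrite (bigD1 i) //= ci mul0r mulr0 eq_sym oner_neq0.
Qed.

(** The homogeneous form of y (y - 1)^(r-1) = w for y = 1 / (1 - c): it comes from
    A - B - c A = (1 - c) (A - y B). *)
Lemma prod_inv_one_sub_root (A B : {poly K}) : A != 0 ->
  \prod_i (A - (1 - c i)^-1 *: B)
  = A * (A - B) ^+ r.-1 - ((-1) ^+ r.-1 * x) *: B ^+ r.
Proof.
move=> A0.
have factor i : A - B - c i *: A = (1 - c i) *: (A - (1 - c i)^-1 *: B).
  rewrite scalerBr scalerA divff ?one_sub_root_neq0 //.
  by rewrite scalerBl !scale1r addrAC.
have := prod_root_homogenized (A - B) A0.
rewrite (_ : A - B - A = - B); last by ring.
rewrite [X in _ = _ *: X](eq_bigr _ (fun i _ => factor i)).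
rewrite scaler_prod scalerA prod_one_sub_root scale1r => <-.
rewrite addrC (exprNn B) -{2}(prednK r0) exprS mulN1r mulNr scalerN -scalerA.
by congr (_ - _); rewrite -[RHS]mul_polyC -scalerAr polyC_exp polyCN.
Qed.

End Roots.

(** * The congruence *)

Section Congruence.
Variables (p : nat) (hp : prime p) (p_odd : odd p).
Variables (F : fieldType) (F0 : [pchar F] =i pred0).

Let nat0 k : (0 < k)%N -> k%:R != 0 :> F.
Proof. by move=> k0; rewrite (natr_eq0_pchar0 F0) -lt0n. Qed.

Let natr_divz (z : int) : (p %| z)%Z -> p%:R * (z %/ p)%Z%:~R = z%:~R :> F.
Proof. by move=> pz; rewrite -{2}(divzK pz) rmorphM /= -pmulrn mulrC. Qed.

(** This is 1/k = (-1)^(k-1) binom(p, k) / p + p e_k / k, summed with the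
    binomial expansion of 1 = (y - (y - 1))^p; the error e_k is an integer by
    [pred_bin_modp] because binom(p, k) / p = binom(p - 1, k - 1) / k. *)
Lemma homogenized_log : exists e : nat -> int, forall y : F,
  \sum_(1 <= k < p) k%:R^-1 * ((y - 1) ^+ k * y ^+ (p - k))
  = (y ^+ p - (y - 1) ^+ p - 1) / p%:R
    + p%:R * \sum_(1 <= k < p)
        (e k)%:~R * (k%:R^-1 * ((y - 1) ^+ k * y ^+ (p - k))).
Proof.
exists (fun k => (1 - (-1) ^+ k.-1 * 'C(p.-1, k.-1)%:Z) %/ p)%Z => y.
have p0 : p%:R != 0 :> F by rewrite nat0 ?prime_gt0.
have eE k : (0 < k < p)%N -> k%:R^-1 = (-1) ^+ k.-1 * 'C(p, k)%:R / p%:R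
    + p%:R * ((1 - (-1) ^+ k.-1 * 'C(p.-1, k.-1)%:Z) %/ p)%Z%:~R / k%:R :> F.
  move=> k0p; have k0 : k%:R != 0 :> F by apply: nat0; lia.
  rewrite natr_divz ?pred_bin_modp //.
  have : p%:R * 'C(p.-1, k.-1)%:R = k%:R * 'C(p, k)%:R :> F.
    by rewrite -!natrM mul_bin_diag prednK //; lia.
  rewrite rmorphB rmorphM rmorphXn rmorphN rmorph1 /= -pmulrn => binE.
  have -> : 'C(p.-1, k.-1)%:R = k%:R * 'C(p, k)%:R / p%:R :> F.
    by rewrite -binE mulrAC divff // mul1r.
  by field; rewrite k0 p0.
have expandE : 1 = y ^+ p + \sum_(1 <= k < p)
    (-1) ^+ k * 'C(p, k)%:R * ((y - 1) ^+ k * y ^+ (p - k)) - (y - 1) ^+ p.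
  transitivity ((y - (y - 1)) ^+ p); first by rewrite subKr expr1n.
  rewrite exprBn -(big_mkord xpredT (fun k =>
    (-1) ^+ k * y ^+ (p - k) * (y - 1) ^+ k *+ 'C(p, k))) /=.
  rewrite big_nat_recr //= big_ltn ?prime_gt0 // subn0 subnn binn bin0 !expr0.
  rewrite !mulr1n mul1r !mulr1 -signr_odd p_odd mulN1r; congr (_ + _ - _).
  apply: eq_bigr => k _; rewrite -[LHS]mulr_natr mulrAC [X in _ = _ * X]mulrC.
  by rewrite mulrA; congr (_ * _); apply: mulrAC.
rewrite [in RHS](_ : y ^+ p - _ - 1 = \sum_(1 <= k < p)
    (-1) ^+ k.-1 * 'C(p, k)%:R * ((y - 1) ^+ k * y ^+ (p - k))); last first.
  rewrite [X in _ - X = _]expandE; set S := \sum_(_ <= _ < _) _.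
  transitivity (- S); first by ring.
  rewrite -sumrN; apply: eq_big_nat => -[//|k] _ /=.
  by rewrite exprS mulN1r !mulNr opprK.
rewrite mulr_suml mulr_sumr -big_split /=; apply: eq_big_nat => k k0p.
by rewrite {1}eE //; ring.
Qed.

Lemma sum_pow_mul_in (S : subringClosed F) (I : finType) (y : I -> F) :
  (forall n, \sum_i y i ^+ n \in S) ->
  forall j n, \sum_i (y i - 1) ^+ j * y i ^+ n \in S.
Proof.
move=> yS; elim=> [|j IH] n; first by under eq_bigr do rewrite mul1r.
under eq_bigr do rewrite exprSr mulrBr mulr1 mulrBl -mulrA -exprS.
by rewrite sumrB rpredB.
Qed.

(** Apply [power_sum_trinomial] to both families: the terms 1 / p cancel, since
    r = (r - 1) + 1, and the terms of the two sums with r k = p cancel each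
    other. *)
Lemma power_sum_difference (I : finType) (y : I -> F) r (x : F) :
    (0 < r)%N -> #|I| = r -> let w := (-1) ^+ r.-1 * x in
    \prod_i (1 - y i *: 'X) = (1 - 1 *: 'X) ^+ r.-1 - w *: 'X^r ->
    \prod_i (1 - (y i - 1) *: 'X) = (1 - (-1) *: 'X) ^+ 1 - w *: 'X^r ->
  \sum_i (y i ^+ p - (y i - 1) ^+ p - 1) / p%:R
  = \sum_(1 <= k < p | (r * k < p)%N) (trinomial_bin p r k)%:~R * (x ^+ k / k%:R).
Proof.
move=> r0 cardI w prodP prodQ; have p0 : p%:R != 0 :> F by rewrite nat0 ?prime_gt0.
have rE : r%:R = 1 + r.-1%:R :> F by rewrite nat1r prednK.
rewrite -mulr_suml !sumrB sumr_const cardI !mulrBl.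
rewrite (power_sum_trinomial F0 r0 (prime_gt0 hp) prodP).
rewrite (power_sum_trinomial F0 r0 (prime_gt0 hp) prodQ).
rewrite expr1n mulr1 -[in (-1) ^+ p]signr_odd p_odd expr1 rE.
pose a k := w ^+ k / k%:R *
  (1 ^+ (p - r * k) * 'C((p - r * k + r.-1 * k).-1, p - r * k)%:R).
pose b k := w ^+ k / k%:R *
  ((-1) ^+ (p - r * k) * 'C((p - r * k + 1 * k).-1, p - r * k)%:R).
transitivity (\sum_(1 <= k < p.+1 | (r * k <= p)%N) a k
            - \sum_(1 <= k < p.+1 | (r * k <= p)%N) b k); first by field.
rewrite -sumrB [RHS]big_mkcond [LHS]big_mkcond big_nat_recr ?prime_gt0 //=.
have abE k : a k - b k = (trinomial_bin p r k)%:~R * (x ^+ k / k%:R).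
  rewrite rmorphM rmorphB rmorphM !rmorphXn rmorphN rmorph1 /= -!pmulrn.
  by rewrite /a /b mul1n expr1n /w exprMn -exprM; ring.
have bin0E k : (r * k)%N = p -> trinomial_bin p r k = 0.
  by move=> rk; rewrite /trinomial_bin rk subnn !bin0 subrr mulr0.
rewrite [X in _ + X](_ : _ = 0) ?addr0.
  apply: eq_big_nat => k _; case: ltngtP => // rk.
  by rewrite abE bin0E // mul0r.
case: leqP => // rp; rewrite abE bin0E ?mul0r //.
by apply/eqP; rewrite eqn_leq rp leq_pmull.
Qed.

(** The only properties of Z_p[x] that the congruence uses are the hypotheses on
    S, so that all computations take place in an arbitrary field of
    characteristic 0. *)
Lemma congruence_in_subring (S : subringClosed F) r (x : F) (c : 'I_r -> F) :
    (forall k, (0 < k < p)%N -> k%:R^-1 \in S) -> x \in S -> (0 < r)%N ->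
    x *: ('X - 1) ^+ r + 'X^(r.-1) = x *: \prod_(i < r) ('X - (c i)%:P) ->
  exists2 s, s \in S &
    \sum_(1 <= k < p | (r * k < p)%N) ('C(r * k, k))%:R * (x ^+ k / k%:R)
    + \sum_(i < r) truncated_log p (c i) / (1 - c i) ^+ p = p%:R * s.
Proof.
move=> SV Sx r0 hc; pose w := (-1) ^+ r.-1 * x; pose y i := (1 - c i)^-1.
have c1 := one_sub_root_neq0 r0 hc.
have prod_y (A B : {poly F}) := prod_inv_one_sub_root r0 hc (A := A) B.
have prodP : \prod_i (1 - y i *: 'X) = (1 - 1 *: 'X) ^+ r.-1 - w *: 'X^r.
  by rewrite prod_y ?oner_neq0 // mul1r scale1r.
have prodQ : \prod_i (1 - (y i - 1) *: 'X) = (1 - (-1) *: 'X) ^+ 1 - w *: 'X^r.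
  have X1 : 1 + 'X != 0 :> {poly F}.
    by rewrite addrC -[1]opprK -polyCN polyXsubC_eq0.
  transitivity (\prod_i (1 + 'X - y i *: 'X)).
    by apply: eq_bigr => i _; rewrite scalerBl scale1r opprB addrA.
  by rewrite prod_y // addrK expr1n mulr1 scaleN1r opprK.
have sumD := power_sum_difference r0 (card_ord r) prodP prodQ.
have Sy n : \sum_i y i ^+ n \in S.
  apply: (power_sum_integral F0); rewrite prodP.
  rewrite rpredB ?rpredX ?polyOverZ ?polyOverXn ?rpredM ?rpredX ?rpredN1 //.
  by rewrite rpredB ?rpred1 // scale1r polyOverX.
have [e eE] := homogenized_log.
have logE i : truncated_log p (c i) / (1 - c i) ^+ p =
    \sum_(1 <= k < p) k%:R^-1 * ((y i - 1) ^+ k * y i ^+ (p - k)).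
  rewrite /truncated_log mulr_suml; apply: eq_big_nat => k /andP[_ kp].
  rewrite (_ : y i - 1 = c i * y i); last by rewrite /y; field.
  rewrite exprMn -[_ * _ * y i ^+ _]mulrA -exprD subnKC 1?ltnW // exprVn.
  by rewrite mulrCA mulrA.
pose E k := trinomial_bin p r k + 'C(r * k, k)%:Z.
(* the errors of the binomial congruence and of the truncated logarithm *)
exists (\sum_(1 <= k < p | (r * k < p)%N) (E k %/ p)%Z%:~R * (x ^+ k / k%:R)
  + \sum_(1 <= k < p) (e k)%:~R *
      (k%:R^-1 * \sum_i (y i - 1) ^+ k * y i ^+ (p - k))).
  rewrite rpredD //; rewrite big_nat_cond; apply: rpred_sum => k /andP[k0p _].
    by rewrite rpredM ?rpred_int // rpredM ?rpredX ?SV.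
  by rewrite rpredM ?rpred_int // rpredM ?SV // sum_pow_mul_in.
under [X in _ + X = _]eq_bigr do rewrite logE eE.
rewrite big_split /= sumD addrA mulrDr; congr (_ + _).
  rewrite -big_split mulr_sumr /= big_nat_cond [RHS]big_nat_cond.
  apply: eq_bigr => k /andP[k0p rkp]; rewrite [RHS]mulrA natr_divz; last first.
    by apply: trinomial_bin_modp => //; case/andP: k0p.
  by rewrite rmorphD mulrDl addrC.
rewrite -mulr_sumr exchange_big /=; congr (_ * _); apply: eq_bigr => k _.
by rewrite -!mulr_sumr.
Qed.

End Congruence.

Theorem theorem4 (p : nat) (hp : prime p) (p_odd : odd p)
    (r : nat) (hr : (1 <= r < p)%N)
    (L : fieldExtType (Qpx hp)) (c : 'I_r -> L) (x : L) (hx : x = (indet hp)%:A)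
    (hL : splittingFieldFor 1 (x *: ('X - 1) ^+ r + 'X^(r.-1)) {:L})
    (hc : x *: ('X - 1) ^+ r + 'X^(r.-1) = x *: \prod_(i < r) ('X - (c i)%:P)) :
  gauss_congr 1
    (\sum_(1 <= k < p | (r * k < p)%N) ('C(r * k, k))%:R * (x ^+ k / k%:R))
    (- \sum_(i < r) truncated_log p (c i) / (1 - c i) ^+ p).
Proof.
have /andP[r0 _] := hr.
have Sx : x \in @intpoly_image p hp L by rewrite hx intpoly_image_indet.
have [s /intpoly_imageP[q ->] lhsE] := congruence_in_subring hp p_odd
  (Qpx_ext_pchar0 L) (@intpoly_image_natV p hp L) Sx r0 hc.
pose a : Qpx hp :=
  \sum_(1 <= k < p | (r * k < p)%N) ('C(r * k, k))%:R * (indet hp ^+ k / k%:R).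
exists a, (a - p%:R * intpoly_frac q); have aE : a%:A =
    \sum_(1 <= k < p | (r * k < p)%N) ('C(r * k, k))%:R * (x ^+ k / k%:R).
  rewrite -in_algE rmorph_sum; apply: eq_bigr => k _.
  by rewrite rmorphM fmorph_div rmorphXn !rmorph_nat hx.
split=> //; last first.
  exists (intpoly_frac q); first exact: intpoly_gauss_ring.
  by rewrite expr1 opprB addrC subrK.
have -> : (a - p%:R * intpoly_frac q)%:A = a%:A - p%:R * in_alg L (intpoly_frac q).
  by rewrite -!in_algE rmorphB rmorphM rmorph_nat.
by rewrite -lhsE aE opprD addrA subrr add0r.
Qed.
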